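(* Fix $M, \varepsilon > 0$ and $a \geq 16 M \varepsilon^{-1} + 8M$. Let $U_1, U_2, \ldots$ be i.i.d. random variables uniformly distributed on the union of intervals $[-a-M, -a+M] \cup [a-M, a+M]$; let $N$ be a random variable independent of $(U_i)_{i\ge1}$ with $\mathbb{P}[N=n] = 2^{-1-n}$ for $n \in \{0,1,2,\ldots\}$; and let $R_1, R_2$ be independent random variables, independent of $N$ and $U_1, U_2, \ldots$, each uniformly distributed on $[-a,a]$. Define $$Z = R_1 + R_2 + (U_1 + U_2 + \cdots + U_N).$$ Then for every pair of random variables $X, Y$ independent of $Z$, supported in $[-M,M]$, with $\mathbb{E}[X] - \mathbb{E}[Y] \geq \varepsilon M$, it holds that $$X + Z >_1 Y + Z.$$
   Context: The sum $U_1+\cdots+U_N$ is $0$ when $N=0$. For real random variables $X,Y$, write $X \geq_1 Y$ if $\mathbb{E}[\phi(X)] \geq \mathbb{E}[\phi(Y)]$ for every increasing (i.e. non-decreasing) function $\phi:\mathbb{R}\to\mathbb{R}$ for which the two expectations are well defined; equivalently, $F_X(t)\le F_Y(t)$ for all $t$. Write $X >_1 Y$ if $X \geq_1 Y$ and $X$ and $Y$ have distinct distributions. *)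

(* Defs.v *)
From HB Require Import structures.
From mathcomp Require Import all_boot all_order all_algebra finmap.
From mathcomp Require Import all_classical all_reals all_analysis.
From mathcomp Require Import measurable_realfun.
Import Order.TTheory GRing.Theory Num.Theory.
Import numFieldNormedType.Exports.

Set Implicit Arguments.
Unset Strict Implicit.
Unset Printing Implicit Defensive.

Local Open Scope classical_set_scope.
Local Open Scope ring_scope.

(* Independence of two classes of events; between the classes <<s G >> and
   <<s H >> this is the independence of the generated sigma-algebras. *)
Definition indep_classes d (T : measurableType d) (R : realType)
    (P : probability T R) (F G : set (set T)) : Prop :=
  forall A B, F A -> G B -> P (A `&` B) = (P A * P B)%E.

Definition indep_RV d d1 d2 (T : measurableType d) (T1 : measurableType d1)
    (T2 : measurableType d2) (R : realType) (P : probability T R)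
    (X : {mfun T >-> T1}) (Y : {mfun T >-> T2}) : Prop :=
  indep_classes P (g_sigma_algebra_preimage X) (g_sigma_algebra_preimage Y).

Definition mutually_indep_RV d d' (T : measurableType d)
    (T' : measurableType d') (R : realType) (P : probability T R)
    (U : nat -> {mfun T >-> T'}) : Prop :=
  forall (J : {fset nat}) (B : nat -> set T'),
    (forall i, measurable (B i)) ->
    P (\bigcap_(i in [set` J]) (U i @^-1` B i)) =
    (\prod_(i <- J) P (U i @^-1` B i))%E.

Definition uniform_itv_RV d (T : measurableType d) (R : realType)
    (P : probability T R) (a b : R) (X : {RV P >-> R}) : Prop :=
  exists ab : a < b, forall A : set R, measurable A ->
    distribution P X A = uniform_prob ab A.
Arguments uniform_itv_RV {d T R} P a b X.

(* Meaningful for S measurable with 0 < lebesgue_measure S < +oo. *)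
Definition uniform_on_RV d (T : measurableType d) (R : realType)
    (P : probability T R) (S : set R) (X : {RV P >-> R}) : Prop :=
  forall A : set R, measurable A ->
    distribution P X A =
    (lebesgue_measure (A `&` S) / lebesgue_measure S)%E.
Arguments uniform_on_RV {d T R} P S X.

Definition supported_in d (T : measurableType d) (R : realType)
    (P : probability T R) (X : {RV P >-> R}) (A : set R) : Prop :=
  distribution P X A = 1%E.
Arguments supported_in {d T R} P X A.

(* The expectation of f, possibly infinite, is well defined unless its positive
   and negative parts both have infinite expectation. *)
Definition expectation_defined d (T : measurableType d) (R : realType)
    (P : probability T R) (f : T -> R) : Prop :=
  measurable_fun [set: T] f /\
  (\int[P]_w (EFin \o f)^\+ w < +oo \/ \int[P]_w (EFin \o f)^\- w < +oo)%E.

Definition fosd_ge d (T : measurableType d) (R : realType)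
    (P : probability T R) (X Y : {RV P >-> R}) : Prop :=
  forall phi : R -> R, nondecreasing_fun phi ->
    expectation_defined P (phi \o X) -> expectation_defined P (phi \o Y) ->
    ('E_P[phi \o X] >= 'E_P[phi \o Y])%E.
Arguments fosd_ge {d T R} P X Y.

(* Equality of distributions is tested on measurable sets only: on other sets
   the values of [distribution] carry no meaning. *)
Definition fosd_gt d (T : measurableType d) (R : realType)
    (P : probability T R) (X Y : {RV P >-> R}) : Prop :=
  fosd_ge P X Y /\
  ~ (forall A : set R, measurable A -> distribution P X A = distribution P Y A).
Arguments fosd_gt {d T R} P X Y.

Definition random_sum d (T : measurableType d) (R : realType)
    (U : nat -> {mfun T >-> R}) (N : {mfun T >-> nat}) : T -> R :=
  fun w => \sum_(i < N w) U i w.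

Lemma measurable_random_sum d (T : measurableType d) (R : realType)
    (U : nat -> {mfun T >-> R}) (N : {mfun T >-> nat}) :
  measurable_fun [set: T] (random_sum U N).
Proof.
move=> _ B mB; rewrite setTI.
pose S n w : R := \sum_(i < n) U i w.
have mS n : measurable_fun [set: T] (S n).
  by apply: measurable_sum => i; exact: measurable_funPT.
have -> : random_sum U N @^-1` B = \bigcup_n (N @^-1` [set n] `&` S n @^-1` B).
  by apply/seteqP; split=> [w Bw|w [n _ [/= <-]]]//; exists (N w).
apply: bigcup_measurable => n _; apply: measurableI.
  exact: measurable_funPTI.
by rewrite -[X in measurable X]setTI; exact: mS.
Qed.

HB.instance Definition _ d (T : measurableType d) (R : realType)
    (U : nat -> {mfun T >-> R}) (N : {mfun T >-> nat}) :=
  isMeasurableFun.Build _ _ T R (random_sum U N) (measurable_random_sum U N).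

(* Main.v *)
(** Write Z = Q + S with Q = R1 + R2, whose density is the tent
    rho(v) = (2a - |v|)^+ / (4a^2) with cdf H, and S the geometric sum. The
    slope of rho is piecewise constant, so for |y| <= M the value H(v - y)
    equals H(v) - y rho(v) up to M^2 / (4a^2), and exactly if |v| > 2a + M.
    Averaging over v = t - S and then over y = X or y = Y bounds
    P(Y + Z <= t) - P(X + Z <= t) below by M / (4a^2) times E[w(t - S)], where
    w(v) = eps (2a - |v|)^+ - 2M 1(|v| <= 2a + M). The weight w is at least 8M
    on the core |v| <= a + 2M, at least -2M on the collar
    a + 2M < |v| <= 2a + M, and 0 elsewhere. From the collar the next step
    U_{n+1} enters the core with probability at least 1/2, and
    P(N = n) = 2 P(N = n + 1), so
    P(t - S in collar) <= 4 P(t - S in core, N > 0), whence E[w(t - S)] >= 0.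
    At t = 0 the event N = 0 makes the inequality strict. *)
Require Import Defs.
From HB Require Import structures.
From mathcomp Require Import all_boot all_order all_algebra.
From mathcomp Require Import all_classical all_reals all_analysis.
From mathcomp Require Import measurable_realfun.
From mathcomp Require Import finmap ring lra.
Import Order.TTheory GRing.Theory Num.Theory.
Import numFieldNormedType.Exports.

Local Open Scope classical_set_scope.
Local Open Scope ring_scope.

(** * From the pointwise order of cdfs to first-order stochastic dominance *)

Section dominance.
Context {R : realType} {d} {T : measurableType d} {P : probability T R}.
Implicit Types X Y : {RV P >-> R}.

(** The infimum decides the shape: without a lower bound the set is empty or the whole line,
    otherwise it is empty or a ray, closed exactly when it contains its infimum. *)
Lemma upper_set_cases (A : set R) :
  (forall x y, A x -> x <= y -> A y) ->
  [\/ A = set0, A = setT, exists c, A = `]c, +oo[%classic |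
      exists c, A = `[c, +oo[%classic].
Proof.
move=> upA; have [->|/set0P A0] := eqVneq A set0; first exact: Or41.
have [lA|nlA] := pselect (has_lbound A); last first.
  apply: Or42; apply/seteqP; split => // y _.
  apply: contrapT => nAy; apply: nlA; exists y => x Ax.
  by rewrite leNgt; apply/negP => /ltW /(upA _ _ Ax).
have infA : has_inf A by split.
have [Ac|nAc] := pselect (A (inf A)).
  apply: Or44; exists (inf A).
  apply/seteqP; split => x /=; rewrite in_itv/= andbT.
    by move=> Ax; exact: ge_inf.
  exact: upA.
apply: Or43; exists (inf A).
  apply/seteqP; split => x /=; rewrite in_itv/= andbT.
  move=> Ax; rewrite lt_neqAle ge_inf// andbT.
  by apply: contra_notN nAc => /eqP ->.
by move=> /(inf_lt A0)[y Ay /ltW]; exact: upA.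
Qed.

(** Continuity of [P] from above along the events X > c - 1/(n+1). It carries inequalities from open
    rays, measured by [ccdf], to closed rays. *)
Lemma cvg_ccdf_left X (c : R) :
  ccdf X (c - n.+1%:R^-1) @[n --> \oo] --> P (X @^-1` `[c, +oo[).
Proof.
pose F n := X @^-1` `]c - n.+1%:R^-1, +oo[.
have -> : X @^-1` `[c, +oo[ = \bigcap_n F n.
  apply/seteqP; split => x /=; rewrite ?in_itv/= ?andbT.
    move=> cx n _; rewrite /F/= in_itv/= andbT.
    by rewrite (lt_le_trans _ cx)// ltrBlDr ltrDl invr_gt0.
  move=> Fx; rewrite leNgt; apply/negP => xc.
  have /ltr_add_invr[k] := xc.
  have := Fx k I; rewrite /F/= in_itv/= andbT ltrBlDr => /lt_trans h /h.
  by rewrite ltxx.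
apply: (@nonincreasing_cvg_mu _ _ _ P F) => //=.
- by rewrite -ge0_fin_numE// fin_num_measure//; exact: measurable_funPTI.
- by move=> n; exact: measurable_funPTI.
- by apply: bigcap_measurable => // n _; exact: measurable_funPTI.
- move=> m n mn; apply/subsetPset => x; rewrite /F/= !in_itv/= !andbT.
  apply: le_lt_trans; rewrite lerD2l lerN2 lef_pV2 ?posrE//.
  by rewrite ler_nat ltnS.
Qed.

(** A monotone [phi] may jump, so its superlevel sets can be rays of either kind; open ones are
    compared by [ccdf], closed ones by a limit. *)
Lemma upper_set_le X Y (A : set R) :
  (forall t, cdf X t <= cdf Y t)%E ->
  (forall x y, A x -> x <= y -> A y) -> (P (Y @^-1` A) <= P (X @^-1` A))%E.
Proof.
move=> cXY /upper_set_cases.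
have ccXY t : (ccdf Y t <= ccdf X t)%E by rewrite !ccdf_1_cdf leeB.
case=> [->|->|[c ->]|[c ->]].
- by rewrite !preimage_set0.
- by rewrite !preimage_setT.
- exact: ccXY.
- have cY := @cvg_ccdf_left Y c; have cX := @cvg_ccdf_left X c.
  rewrite -(cvg_lim _ cY)// -(cvg_lim _ cX)//.
  apply: lee_lim; [by apply/cvg_ex; eexists; exact: cY|
    by apply/cvg_ex; eexists; exact: cX|].
  by apply: nearW => n.
Qed.

(** Layer-cake formula: the integral of a nonnegative function is that of its tail probability over
    r >= 0. *)
Lemma ge0_expectation_le (f g : T -> R) :
  measurable_fun setT f -> measurable_fun setT g ->
  (forall x, 0 <= f x) -> (forall x, 0 <= g x) ->
  (forall r, P (f @^-1` `]r, +oo[) <= P (g @^-1` `]r, +oo[))%E ->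
  (\int[P]_x (f x)%:E <= \int[P]_x (g x)%:E)%E.
Proof.
move=> mf mg f0 g0 fg.
pose F := HB.pack_for {RV P >-> R} f (isMeasurableFun.Build _ _ _ _ f mf).
pose G := HB.pack_for {RV P >-> R} g (isMeasurableFun.Build _ _ _ _ g mg).
have := @ge0_expectation_ccdf _ _ _ P F f0.
have := @ge0_expectation_ccdf _ _ _ P G g0.
rewrite !expectation_def/= => -> ->.
apply: ge0_le_integral => //=.
- by apply: measurable_funTS; exact: ccdf_measurable.
- by apply: measurable_funTS; exact: ccdf_measurable.
- by move=> r _; exact: fg.
Qed.

(** The positive and negative parts of [phi] are compared separately through their superlevel sets.
    Those of the positive part are up-closed; those of the negative part are complements of
    up-closed sets, which reverses the inequality, as the subtraction requires. *)
Lemma cdf_le_fosd_ge X Y :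
  (forall t, cdf X t <= cdf Y t)%E -> fosd_ge P X Y.
Proof.
move=> cXY phi ndphi [mX _] [mY _].
have mpos (f : T -> R) : measurable_fun setT f -> measurable_fun setT f^\+.
  by move=> mf; exact: measurable_funrpos.
have mneg (f : T -> R) : measurable_fun setT f -> measurable_fun setT f^\-.
  by move=> mf; exact: measurable_funrneg.
rewrite unlock [leLHS]integralE [leRHS]integralE.
rewrite !funerpos !funerneg; apply: leeB.
- apply: ge0_expectation_le => [||x|x|r]; rewrite ?funrpos_ge0//.
    exact: mpos.
    exact: mpos.
  have toA (W : {RV P >-> R}) : (phi \o W)^\+ @^-1` `]r, +oo[ =
      W @^-1` [set y | r < Num.max (phi y) 0].
    by apply/seteqP; split => x; rewrite /= in_itv/= andbT.
  rewrite !toA; apply: upper_set_le => // x y /=.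
  rewrite !lt_max => /orP[rx|->] xy; rewrite ?orbT//.
  by rewrite (lt_le_trans rx)// ndphi.
- apply: ge0_expectation_le => [||x|x|r]; rewrite ?funrneg_ge0//.
    exact: mneg.
    exact: mneg.
  pose A := [set y | r < Num.max (- phi y) 0].
  have toA (W : {RV P >-> R}) : (phi \o W)^\- @^-1` `]r, +oo[ = W @^-1` A.
    by apply/seteqP; split => x; rewrite /A/= in_itv/= andbT.
  have mA (W : {RV P >-> R}) : measurable_fun setT (phi \o W) ->
      measurable (W @^-1` A).
    move=> mW; rewrite -toA -[X in measurable X]setTI.
    exact: (mneg _ mW measurableT _ (measurable_itv `]r, +oo[)).
  have PC (W : {RV P >-> R}) : measurable_fun setT (phi \o W) ->
      P (W @^-1` A) = (1 - P (W @^-1` (~` A)))%E.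
    move=> /mA mWA; rewrite preimage_setC probability_setC//.
    by rewrite oppeB ?fin_num_adde_defr// addeA subee// add0e.
  rewrite !toA !PC//; apply: leeB => //; apply: upper_set_le => // x y.
  rewrite /A/= => /negP; rewrite -leNgt => Ax xy; apply/negP; rewrite -leNgt.
  move: Ax; rewrite !ge_max => /andP[+ ->]; rewrite andbT; apply: le_trans.
  by rewrite lerN2 ndphi.
Qed.

End dominance.

(** * Convolution of laws, and independence of a partial sum from the next step *)

Section independence.
Context {R : realType} {d} {T : measurableType d} {P : probability T R}.
Implicit Types U : nat -> {RV P >-> R}.

(** Under independence the joint law agrees with the product of the marginals on rectangles, hence
    everywhere; the product measure of the half-plane x + z <= t is the integral of its sections. *)
Lemma cdfD_indep (X Z : {RV P >-> R}) (t : R) : indep_RV P X Z ->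
  (cdf (P := P) (X \+ Z)%R t = \int[P]_w cdf Z (t - X w))%E.
Proof.
move=> XZ.
have mXZ : measurable_fun setT (fun w => (X w, Z w)).
  by apply: measurable_fun_pair; exact: measurable_funPT.
pose J := HB.pack_for {RV P >-> (R * R)%type} (fun w => (X w, Z w))
  (isMeasurableFun.Build _ _ _ _ (fun w => (X w, Z w)) mXZ).
pose D : set (R * R) := [set p | p.1 + p.2 <= t].
have mD : measurable D.
  have -> : D = setT `&` (fun p : R * R => p.1 + p.2) @^-1` `]-oo, t].
    by apply/seteqP; split => p; rewrite /D/= in_itv/=; [|case].
  exact: measurable_funD.
have -> : cdf (P := P) (X \+ Z) t = distribution P J D.
  by congr (P _); apply/seteqP; split => w; rewrite /D/= in_itv/=.
rewrite -(@product_measure_unique _ _ _ _ _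
    (distribution P X) (distribution P Z)) //; last first.
  move=> A B mA mB; rewrite /distribution /pushforward/=.
  by apply: (XZ (X @^-1` A)); [exists A|exists B]; rewrite ?setTI.
rewrite /product_measure1 ge0_integral_distribution//; last first.
  exact: measurable_fun_xsection.
apply: eq_integral => w _ /=; congr (distribution P Z _).
by apply/seteqP; split => z; rewrite /xsection/= in_itv/= in_setE /D/= lerBrDl.
Qed.

(** Both sides are finite measures in [A], namely [P] restricted to [F] and [P] scaled by [P F].
    They agree on the pi-system [G], hence on the sigma-algebra it generates. *)
Lemma indep_classes_g_sigma (G : set (set T)) (F : set T) :
  G `<=` measurable -> setI_closed G -> G setT -> measurable F ->
  (forall A, G A -> P (A `&` F) = P A * P F)%E ->
  forall A, <<s G >> A -> (P (A `&` F) = P A * P F)%E.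
Proof.
move=> mG GI GT mF GF A sGA.
have PF0 : 0 <= fine (P F) by rewrite fine_ge0.
have /= := @g_sigma_algebra_measure_unique _ R T G mG (fun=> setT) (fun=> GT) _
  (mrestr P mF) (mscale (NngNum PF0) P) GI _ _ A sGA.
rewrite /mrestr /mscale/= fineK ?fin_num_measure// (muleC (P A)); apply.
- by rewrite bigcup_const.
- by move=> B GB; rewrite GF// muleC.
- by move=> _; rewrite setTI -ge0_fin_numE// fin_num_measure.
Qed.

Definition partial_sum (U : nat -> {RV P >-> R}) n w : R := \sum_(i < n) U i w.

Lemma measurable_partial_sum U n : measurable_fun setT (partial_sum U n).
Proof. by apply: measurable_sum => i; exact: measurable_funPT. Qed.

(** With [T] retyped to carry only the sigma-algebra of the first n steps, each of these steps is
    still measurable, and so is their sum. *)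
Lemma partial_sum_g_sigma U n (A : set R) : measurable A ->
  <<s \bigcup_(i in `I_n) g_sigma_algebra_preimage (U i) >>
    (partial_sum U n @^-1` A).
Proof.
set G := \bigcup_(i in _) _ => mA.
have mU (i : 'I_n) :
    measurable_fun [set: g_sigma_algebraType G]
      (U i : g_sigma_algebraType G -> R).
  move=> _ B mB; rewrite setTI; apply: sub_gen_smallest.
  by exists i => /=; [exact: ltn_ord|exists B => //; rewrite setTI].
have : measurable_fun [set: g_sigma_algebraType G]
    (partial_sum U n : g_sigma_algebraType G -> R).
  exact: measurable_sum.
by move=> /(_ measurableT A mA); rewrite setTI.
Qed.

(** Mutual independence speaks of finite intersections of events [U i] in [C i]. Those over i < n
    form a pi-system whose sigma-algebra contains the events of the partial sum. *)
Lemma partial_sum_indep U n (A B : set R) : mutually_indep_RV P U ->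
  measurable A -> measurable B ->
  (P (partial_sum U n @^-1` A `&` U n @^-1` B) =
   P (partial_sum U n @^-1` A) * P (U n @^-1` B))%E.
Proof.
move=> Uindep mA mB.
pose G := [set E | exists C : nat -> set R, (forall i, measurable (C i)) /\
  E = \bigcap_(i in `I_n) U i @^-1` C i].
have mUn (i : nat) C : measurable C -> measurable (U i @^-1` C).
  by move=> mC; exact: measurable_funPTI.
apply: (@indep_classes_g_sigma G).
- move=> _ [C [mC ->]]; apply: fin_bigcap_measurable => // i _; exact: mUn.
- move=> _ _ [C [mC ->]] [C' [mC' ->]]; exists (fun i => C i `&` C' i); split.
    by move=> i; exact: measurableI.
  by rewrite -bigcapI.
- by exists (fun=> setT); split => //; apply/esym; rewrite -subTset.
- exact: mUn.
- move=> _ [C [mC ->]].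
  pose J := [fset i | i in iota 0 n]%fset.
  have JE : `I_n = [set` J].
    by apply/seteqP; split => i /=; rewrite !inE mem_iota add0n.
  have nJ : n \notin J by rewrite !inE mem_iota add0n ltnn.
  (* The partial sum uses indices below n only, so n is fresh: a single family with [B] at n lets
     mutual independence be applied once to [J] enlarged by n. *)
  pose C' i := if i == n then B else C i.
  have mC' i : measurable (C' i) by rewrite /C'; case: ifP.
  have C'J i : i \in J -> C' i = C i.
    by rewrite /C'; case: eqP => // ->; rewrite (negbTE nJ).
  have /= := Uindep (n |` J)%fset C' mC'.
  rewrite big_fsetU1//= {2}/C' eqxx.
  have -> : \bigcap_(i in [set` (n |` J)%fset]) U i @^-1` C' i =
            \bigcap_(i in [set` J]) U i @^-1` C i `&` U n @^-1` B.
    apply/seteqP; split => w /=.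
      move=> CU; split => [i iJ|].
        rewrite -(C'J _ iJ); apply: CU.
        by rewrite /= in_fset1U (iJ : i \in J) orbT.
      by have := CU n; rewrite /C' eqxx; apply; rewrite /= in_fset1U eqxx.
    move=> [CU Un] i /=; rewrite in_fset1U => /predU1P[->|iJ].
      by rewrite /C' eqxx.
    by rewrite C'J//; exact: CU.
  rewrite JE => ->; rewrite muleC; congr (_ * _)%E.
  rewrite (Uindep J C mC); apply: eq_big_seq => i iJ.
  by rewrite C'J.
- move: (@partial_sum_g_sigma U n A mA); apply: smallest_sub.
    exact: smallest_sigma_algebra.
  move=> _ [i /= ltin [C mC <-]]; apply: sub_gen_smallest.
  (* An event about one step is a cylinder with trivial constraints at the other indices. *)
  exists (fun j => if j == i then C else setT); split.
    by move=> j; case: ifP.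
  rewrite setTI; apply/seteqP; split => w /=.
    by move=> Cw j _; case: eqP => // ->.
  by move=> /(_ i ltin); rewrite eqxx.
Qed.

End independence.

(** * The geometric random sum and its passage from collar to core *)

Section random_sums.
Context {R : realType} {d} {T : measurableType d} {P : probability T R}.
Implicit Types (U : nat -> {RV P >-> R}) (N : {RV P >-> nat}).

(** Each side is measurable for the sigma-algebra generated by its own ingredients. The variables
    are rebundled over that smaller measurable space so that [measurable_random_sum] applies
    there. *)
Lemma addR_random_sum_indep U N (R1 R2 : {RV P >-> R}) :
  indep_classes P
    <<s g_sigma_algebra_preimage R1 `|` g_sigma_algebra_preimage R2 >>
    <<s g_sigma_algebra_preimage N `|`
        \bigcup_i g_sigma_algebra_preimage (U i) >> ->
  indep_RV P (R1 \+ R2) (random_sum U N).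
Proof.
set G1 := g_sigma_algebra_preimage R1 `|` _.
set G2 := g_sigma_algebra_preimage N `|` _ => G12.
move=> _ _ [A mA <-] [B mB <-]; apply: G12.
- have mR1 : measurable_fun [set: g_sigma_algebraType G1]
      (R1 : g_sigma_algebraType G1 -> R).
    by move=> _ C mC; apply: sub_gen_smallest; left; exists C.
  have mR2 : measurable_fun [set: g_sigma_algebraType G1]
      (R2 : g_sigma_algebraType G1 -> R).
    by move=> _ C mC; apply: sub_gen_smallest; right; exists C.
  exact: (measurable_funD mR1 mR2 measurableT mA).
- have mN : measurable_fun [set: g_sigma_algebraType G2]
      (N : g_sigma_algebraType G2 -> nat).
    by move=> _ C mC; apply: sub_gen_smallest; left; exists C.
  have mU i : measurable_fun [set: g_sigma_algebraType G2]
      (U i : g_sigma_algebraType G2 -> R).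
    by move=> _ C mC; apply: sub_gen_smallest; right; exists i => //; exists C.
  pose N' : {mfun g_sigma_algebraType G2 >-> nat} :=
    HB.pack (N : g_sigma_algebraType G2 -> nat)
      (isMeasurableFun.Build _ _ _ _ _ mN).
  pose U' i : {mfun g_sigma_algebraType G2 >-> R} :=
    HB.pack (U i : g_sigma_algebraType G2 -> R)
      (isMeasurableFun.Build _ _ _ _ _ (mU i)).
  exact: (@measurable_random_sum _ _ _ U' N' measurableT B mB).
Qed.

Lemma random_sum_fiber U N n (A : set R) :
  indep_classes P (g_sigma_algebra_preimage N)
    <<s \bigcup_i g_sigma_algebra_preimage (U i) >> ->
  measurable A ->
  (P (N @^-1` [set n] `&` random_sum U N @^-1` A) =
   P (N @^-1` [set n]) * P (partial_sum U n @^-1` A))%E.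
Proof.
move=> NU mA; rewrite -NU.
- by congr (P _); apply/seteqP; split => w /= [<-].
- by exists [set n] => //; rewrite setTI.
- have := @partial_sum_g_sigma _ _ _ _ U n A mA; apply: smallest_sub.
    exact: smallest_sigma_algebra.
  by move=> E [i _ EU]; apply: sub_gen_smallest; exists i.
Qed.

(** The fibre N = n on the left is matched with N = n + 1 on the right. The geometric weights cost a
    factor 2 and the assumed step inequality another 2. The shifted fibres fill exactly N > 0, so
    the event N = 0 is kept in reserve. *)
Lemma random_sum_geometric_le U N (A B : set R) :
  indep_classes P (g_sigma_algebra_preimage N)
    <<s \bigcup_i g_sigma_algebra_preimage (U i) >> ->
  (forall n, P (N @^-1` [set n]) = (2 ^- (1 + n))%:E) ->
  measurable A -> measurable B ->
  (forall n, P (partial_sum U n @^-1` A) <=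
             2%:E * P (partial_sum U n.+1 @^-1` B))%E ->
  (P (random_sum U N @^-1` A) <=
   4%:E * P (N @^-1` [set n | (0 < n)%N] `&` random_sum U N @^-1` B))%E.
Proof.
move=> NU Nlaw mA mB AB.
have mS C : measurable C -> measurable (random_sum U N @^-1` C).
  by move=> mC; exact: measurable_funPTI.
have mN n C : measurable C ->
    measurable (N @^-1` [set n] `&` random_sum U N @^-1` C).
  by move=> mC; apply: measurableI; [exact: measurable_funPTI|exact: mS].
have tN (h : nat -> nat) C : injective h ->
    trivIset setT (fun n => N @^-1` [set h n] `&` random_sum U N @^-1` C).
  move=> hI; apply/classical_sets.trivIsetP => i j _ _ ij.
  apply/seteqP; split => // w /=.
  by move=> [[Ni _] [Nj _]]; move/eqP: ij; apply; apply: hI; rewrite -Ni.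
have -> : random_sum U N @^-1` A =
    \bigcup_n (N @^-1` [set n] `&` random_sum U N @^-1` A).
  by apply/seteqP; split => [w Aw|w [n _ []]//]; exists (N w).
have -> : N @^-1` [set n | (0 < n)%N] `&` random_sum U N @^-1` B =
    \bigcup_n (N @^-1` [set n.+1] `&` random_sum U N @^-1` B).
  apply/seteqP; split => [w [/= N0 Bw]|w [n _ [/= -> ]]//].
  by exists (N w).-1 => //; split => //=; rewrite prednK//.
rewrite !measure_bigcup//; [|by move=> n _; exact: mN|
  by apply: tN; exact: succn_inj|by move=> n _; exact: mN|exact: (tN id)].
rewrite -nneseriesZl; last by move=> n _; exact: measure_ge0.
apply: lee_nneseries => [n _ _|n _]; first exact: measure_ge0.
rewrite [leLHS](_ : _ = P (N @^-1` [set n]) * P (partial_sum U n @^-1` A))%E;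
  last exact: random_sum_fiber.
rewrite [X in (_ <= _ * X)%E](_ : _ =
    P (N @^-1` [set n.+1]) * P (partial_sum U n.+1 @^-1` B))%E;
  last exact: random_sum_fiber.
rewrite !Nlaw; apply: (@le_trans _ _
  ((2 ^- (1 + n))%:E * (2%:E * P (partial_sum U n.+1 @^-1` B)))%E).
  by apply: lee_wpmul2l => //; rewrite lee_fin invr_ge0 exprn_ge0.
rewrite !muleA -!EFinM; apply: lee_wpmul2r => //.
rewrite lee_fin [in leRHS]addnS exprS invfM mulrA.
by rewrite le_eqVlt; apply/orP; left; apply/eqP; field.
Qed.

Lemma uniform_half (a M : R) (X : {RV P >-> R}) : 0 < M -> M < a ->
  uniform_on_RV P (`[- a - M, - a + M] `|` `[a - M, a + M]) X ->
  P (X @^-1` `[a - M, a + M]) = (2^-1)%:E /\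
  P (X @^-1` `[- a - M, - a + M]) = (2^-1)%:E.
Proof.
move=> M0 Ma Xunif.
set I1 : set R := `[- a - M, - a + M]%classic.
set I2 : set R := `[a - M, a + M]%classic.
have I1E : lebesgue_measure I1 = (2 * M)%:E.
  rewrite lebesgue_measure_itv/= lte_fin ifT; last by lra.
  by rewrite -EFinB; congr EFin; ring.
have I2E : lebesgue_measure I2 = (2 * M)%:E.
  rewrite lebesgue_measure_itv/= lte_fin ifT; last by lra.
  by rewrite -EFinB; congr EFin; ring.
have I12 : I1 `&` I2 = set0.
  apply/seteqP; split => // x [] /=; rewrite /I1 /I2/= !in_itv/=; lra.
have UE : lebesgue_measure (I1 `|` I2) = (4 * M)%:E.
  have -> : (lebesgue_measure (I1 `|` I2) =
      lebesgue_measure I1 + lebesgue_measure I2)%E.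
    by apply: measureU; [exact: measurable_itv|exact: measurable_itv|].
  by rewrite I1E I2E -EFinD; congr EFin; ring.
have half I : lebesgue_measure I = (2 * M)%:E -> measurable I ->
    I `<=` I1 `|` I2 -> P (X @^-1` I) = (2^-1)%:E.
  move=> IE mI IU; have := Xunif I mI.
  rewrite /distribution /pushforward/= => ->.
  rewrite -/I1 -/I2 setIidl// IE UE inver ifF; last by apply/eqP; lra.
  by rewrite -EFinM; congr EFin; field; lra.
split.
  by apply: half I2E _ _; [exact: measurable_itv|exact: subsetUr].
by apply: half I1E _ _; [exact: measurable_itv|exact: subsetUl].
Qed.

(** The collar has a piece [A1] left of t and a piece [A2] right of t. A step in the interval
    pointing towards t has probability 1/2, is independent of the current position, and leads into
    the core. *)
Lemma partial_sum_step_le U (a M t : R) n : 0 < M -> 4 * M <= a ->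
  mutually_indep_RV P U ->
  uniform_on_RV P (`[- a - M, - a + M] `|` `[a - M, a + M]) (U n) ->
  (P (partial_sum U n @^-1` [set s | a + 2 * M < `|t - s| <= 2 * a + M]%R) <=
   2%:E * P (partial_sum U n.+1 @^-1` [set s | `|t - s| <= a + 2 * M]%R))%E.
Proof.
move=> M0 Ma Uindep Uunif.
have [|Uplus Uminus] := uniform_half a M (U n) M0 _ Uunif; first by lra.
set A := [set s | a + 2 * M < `|t - s| <= 2 * a + M].
set B := [set s | `|t - s| <= a + 2 * M]%R.
pose A1 : set R := `[t - (2 * a + M), t - (a + 2 * M)[%classic.
pose A2 : set R := `]t + (a + 2 * M), t + (2 * a + M)]%classic.
have AE : A = A1 `|` A2.
  apply/seteqP; split => s; rewrite /A/A1/A2/= !in_itv/=.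
    move=> /andP[]; case: (lerP 0 (t - s)) => ts.
      rewrite ger0_norm// => h1 h2; left; apply/andP; split; lra.
    rewrite ltr0_norm// => h1 h2; right; apply/andP; split; lra.
  move=> [/andP[h1 h2]|/andP[h1 h2]].
    rewrite ger0_norm; last by lra.
    apply/andP; split; lra.
  rewrite ler0_norm; last by lra.
  apply/andP; split; lra.
have BE : B = `[t - (a + 2 * M), t + (a + 2 * M)]%classic.
  by apply/seteqP; split => s; rewrite /B/= in_itv/= distrC ler_distl.
have mS k C : measurable C -> measurable (partial_sum U k @^-1` C).
  move=> mC; rewrite -[X in measurable X]setTI.
  exact: (measurable_partial_sum _ _ measurableT).
have mB : measurable B by rewrite BE.
pose I1 : set R := `[- a - M, - a + M]%classic.
pose I2 : set R := `[a - M, a + M]%classic.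
have mUI (I : set R) : measurable I -> measurable (U n @^-1` I).
  by move=> mI; exact: measurable_funPTI.
have mA1 : measurable A1 by exact: measurable_itv.
have mA2 : measurable A2 by exact: measurable_itv.
have mI1 : measurable I1 by exact: measurable_itv.
have mI2 : measurable I2 by exact: measurable_itv.
have A12 : A1 `&` A2 = set0.
  by apply/seteqP; split => // s []; rewrite /A1/A2/= !in_itv/=; lra.
have -> : (P (partial_sum U n @^-1` A) = P (partial_sum U n @^-1` A1) +
    P (partial_sum U n @^-1` A2))%E.
  rewrite AE preimage_setU; apply: measureU; [exact: mS|exact: mS|].
  by rewrite -preimage_setI A12 preimage_set0.
pose E1 := partial_sum U n @^-1` A1 `&` U n @^-1` I2.
pose E2 := partial_sum U n @^-1` A2 `&` U n @^-1` I1.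
have PE1 : P E1 = (P (partial_sum U n @^-1` A1) * (2^-1)%:E)%E.
  by rewrite /E1 partial_sum_indep// Uplus.
have PE2 : P E2 = (P (partial_sum U n @^-1` A2) * (2^-1)%:E)%E.
  by rewrite /E2 partial_sum_indep// Uminus.
have mE1 : measurable E1 by apply: measurableI; [exact: mS|exact: mUI].
have mE2 : measurable E2 by apply: measurableI; [exact: mS|exact: mUI].
have : (P (E1 `|` E2) <= P (partial_sum U n.+1 @^-1` B))%E.
  apply: le_measure; [|by rewrite in_setE; exact: mS|].
    by rewrite in_setE; exact: measurableU.
  (* From distance at most 2a + M, a step of length at least a - M towards t leaves at most a + 2M.
     It cannot overshoot, being at most a + M while the distance is at least a + 2M. *)
  move=> w /=; rewrite BE /E1 /E2 /A1 /A2 /I1 /I2/= !in_itv/=.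
  rewrite [partial_sum _ n.+1 w]big_ord_recr/= -/(partial_sum U n w); lra.
have -> : (P (E1 `|` E2) = P E1 + P E2)%E.
  apply: measureU => //.
  by rewrite /E1 /E2 setIACA -preimage_setI A12 preimage_set0 set0I.
rewrite PE1 PE2 -ge0_muleDl//.
move=> /(lee_wpmul2l (x := 2%:E)) => h.
apply: le_trans (h _); last by rewrite lee_fin.
by rewrite muleCA -EFinM mulfV// mule1.
Qed.
End random_sums.

(** * The tent density, its cdf, and their first-order expansion *)

Section triangular_law.
Context {R : realType}.
Implicit Types (a v x y h t : R) (F f : R -> R).

Definition pos_part x : R := Num.max x 0.

Definition sq_pos x : R := pos_part x ^+ 2.

(** The square of the positive part is convex with derivative 2 [pos_part], which is 2-Lipschitz;
    the two bounds on the Taylor remainder follow. *)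
Lemma sq_pos_taylor x y :
  0 <= sq_pos (x - y) - sq_pos x + 2 * y * pos_part x <= y ^+ 2.
Proof.
rewrite /sq_pos /pos_part.
have [x0|x0] := leP x 0; have [xy0|xy0] := leP (x - y) 0;
  by apply/andP; split; nra.
Qed.

(** Turns remainder bounds such as [sq_pos_taylor] into derivatives, with no case analysis at the
    kinks. *)
Lemma quadratic_is_derive F x l (C : R) :
  (forall h, `|F (x + h) - F x - h * l| <= C * h ^+ 2) -> is_derive x 1 F l.
Proof.
move=> FC.
have C0 : 0 <= C by have := FC 1; rewrite expr1n mulr1; exact: le_trans.
suff cF : h^-1 *: ((F \o shift x) (h *: (1 : R)) - F x) @[h --> 0^'] --> l.
  by apply: DeriveDef; [apply/cvg_ex; exists l|exact/cvg_lim].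
apply/cvgrPdist_le => e e0; near=> h.
have h0 : h != 0 by near: h; exact: nbhs_dnbhs_neq.
(* The added 1 keeps the denominator positive when [C] is 0. *)
have he : `|h| <= e / (C + 1).
  near: h; apply: dnbhs0_le; rewrite divr_gt0// ltr_wpDl//.
have -> : l - h^-1 *: ((F \o shift x) (h *: (1 : R)) - F x) =
    - (h^-1 * (F (x + h) - F x - h * l)).
  rewrite /= !/(_ *: _)/= mulr1 (addrC h x); field; exact: h0.
rewrite normrN normrM normfV ler_pdivrMl ?normr_gt0//.
apply: (le_trans (FC h)); rewrite -real_normK ?num_real// expr2 mulrCA.
rewrite ler_wpM2l//; apply: (@le_trans _ _ ((C + 1) * `|h|)).
  by rewrite ler_wpM2r// lerDl.
by rewrite mulrC -ler_pdivlMr// ltr_wpDl.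
Unshelve. all: by end_near. Qed.

(** The function H, written as a second difference of [sq_pos] so that [sq_pos_taylor] applies term
    by term. *)
Definition triangular_cdf a v : R :=
  (sq_pos (v + 2 * a) - 2 * sq_pos v + sq_pos (v - 2 * a)) / (8 * a ^+ 2).

(** The tent rho, as the termwise derivative of [triangular_cdf]; its closed form is
    [triangular_pdfE]. *)
Definition triangular_pdf a v : R :=
  (pos_part (v + 2 * a) - 2 * pos_part v + pos_part (v - 2 * a)) / (4 * a ^+ 2).

Lemma triangular_pdfE a v : 0 < a ->
  triangular_pdf a v = pos_part (2 * a - `|v|) / (4 * a ^+ 2).
Proof.
move=> a0; rewrite /triangular_pdf /pos_part; congr (_ / _).
have [v0|v0] := leP 0 v.
  rewrite (ger0_norm v0).
  have [?|?] := leP (v + 2 * a) 0; have [?|?] := leP v 0;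
  have [?|?] := leP (v - 2 * a) 0;
  have [?|?] := leP (2 * a - v) 0; lra.
rewrite (ltr0_norm v0).
have [?|?] := leP (v + 2 * a) 0; have [?|?] := leP v 0;
  have [?|?] := leP (v - 2 * a) 0;
have [?|?] := leP (2 * a - - v) 0; lra.
Qed.

(** The error is A - 2B + C over 8a^2, where A, B, C are Taylor remainders in [0, y^2]. The
    combination lies between -2y^2 and 2y^2, whence the constant M^2 / (4a^2). *)
Lemma triangular_cdf_taylor a (M : R) v y : 0 < a -> 0 < M -> `|y| <= M ->
  `|triangular_cdf a (v - y) - (triangular_cdf a v - y * triangular_pdf a v)|
    <= M ^+ 2 / (4 * a ^+ 2) * \1_[set v | `|v| <= 2 * a + M] v.
Proof.
move=> a0 M0 yM.
have y2 : y ^+ 2 <= M ^+ 2.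
  by rewrite -real_normK ?num_real// lerXn2r// nnegrE ltW.
have [/andP[A0 A1] [/andP[B0 B1] /andP[C0 C1]]] :=
  (sq_pos_taylor (v + 2 * a) y,
   (sq_pos_taylor v y, sq_pos_taylor (v - 2 * a) y)).
set A := sq_pos (v + 2 * a - y) - _ + _ in A0 A1.
set B := sq_pos (v - y) - _ + _ in B0 B1.
set C := sq_pos (v - 2 * a - y) - _ + _ in C0 C1.
have -> : triangular_cdf a (v - y) -
    (triangular_cdf a v - y * triangular_pdf a v) =
    (A - 2 * B + C) / 2 / (4 * a ^+ 2).
  rewrite /triangular_cdf /triangular_pdf /A /B /C.
  rewrite (addrAC v (- y)) (addrAC v (- y) (- _)); field; lra.
rewrite indicE (_ : (v \in _) = (`|v| <= 2 * a + M)); last first.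
  by apply/idP/idP; rewrite in_setE.
have [vM|vM] := leP `|v| (2 * a + M).
  have p0 : 0 < (4 * a ^+ 2)^-1 by rewrite invr_gt0 mulr_gt0// exprn_gt0.
  rewrite mulr1n mulr1 normrM (gtr0_norm p0) ler_pM2r// ler_norml.
  by apply/andP; split; lra.
move: yM; rewrite ler_norml => /andP[yM1 yM2].
(* Beyond 2a + M no kink lies between v and v - y, so the three remainders coincide (all y^2 or all
   0) and their second difference vanishes. *)
suff -> : A - 2 * B + C = 0 by rewrite !mul0r mulr0 normr0.
rewrite /A /B /C /sq_pos /pos_part.
have [v0|v0] := leP 0 v.
  move: vM; rewrite ger0_norm// => vM.
  rewrite !max_l; lra.
move: vM; rewrite ltr0_norm// => vM.
rewrite !max_r; lra.
Qed.

End triangular_law.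

(** * The law of the sum of two independent uniform variables *)

Section sum_of_uniforms.
Context {R : realType} {d} {T : measurableType d} {P : probability T R}.

(** A difference of positive parts encodes the ramp from 0 to 1 in a form that integrates to
    differences of [sq_pos]. *)
Lemma uniform_cdfE (a x : R) (X : {RV P >-> R}) : 0 < a ->
  uniform_itv_RV P (- a) a X ->
  cdf X x = ((pos_part (x + a) - pos_part (x - a)) / (2 * a))%:E.
Proof.
move=> a0 [aa XE]; rewrite /cdf XE ?measurable_itv//.
rewrite /uniform_prob integral_uniform_pdf.
rewrite (eq_integral (fun=> ((2 * a)^-1)%:E)); last first.
  move=> r; rewrite in_setE => -[_ /=]; rewrite in_itv/= /uniform_pdf => ->.
  by congr (_^-1)%:E; ring.
rewrite integral_cst/=; last by apply: measurableI; exact: measurable_itv.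
rewrite EFinM muleC; congr (_ * _)%E.
have [xa|ax] := ltP x (- a).
  rewrite (_ : _ `&` _ = set0); last first.
    by apply/seteqP; split => // r [] /=; rewrite !in_itv/=; lra.
  rewrite measure0; congr EFin; rewrite /pos_part !max_r; lra.
have [xa|ax'] := leP x a.
  rewrite (_ : _ `&` _ = `[- a, x]%classic); last first.
    apply/seteqP; split => r /=; rewrite !in_itv/=; last first.
      by move=> ?; split; lra.
    by case; lra.
  rewrite lebesgue_measure_itv/= lte_fin; case: ltP => h.
    by rewrite -EFinB; congr EFin; rewrite /pos_part max_l ?max_r; lra.
  by congr EFin; rewrite /pos_part max_r ?max_r; lra.
rewrite (_ : _ `&` _ = `[- a, a]%classic); last first.
  apply/seteqP; split => r /=; rewrite !in_itv/=; last first.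
      by move=> ?; split; lra.
    by case; lra.
rewrite lebesgue_measure_itv/= lte_fin ifT; last by lra.
by rewrite -EFinB; congr EFin; rewrite /pos_part !max_l; lra.
Qed.

(** Convolution averages the cdf of [R2] at v - r over r in [-a, a]. The fundamental theorem of
    calculus evaluates this by an antiderivative [F]; its values at the two ends share the term
    [sq_pos v], which gives the coefficient 2 in [triangular_cdf]. *)
Lemma cdf_sum_uniformE (a v : R) (R1 R2 : {RV P >-> R}) : 0 < a ->
  uniform_itv_RV P (- a) a R1 -> uniform_itv_RV P (- a) a R2 ->
  indep_RV P R1 R2 ->
  cdf (P := P) (R1 \+ R2) v = (triangular_cdf a v)%:E.
Proof.
move=> a0 U1 U2 ind; rewrite cdfD_indep//.
pose f r : R := (pos_part (v - r + a) - pos_part (v - r - a)) / (2 * a).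
pose F r : R := - (sq_pos (v - r + a) - sq_pos (v - r - a)) / (4 * a).
have FT r h : `|F (r + h) - F r - h * f r| <= (4 * a)^-1 * h ^+ 2.
  have [/andP[A0 A1] /andP[B0 B1]] :=
    (sq_pos_taylor (v - r + a) h, sq_pos_taylor (v - r - a) h).
  set A := sq_pos (v - r + a - h) - _ + _ in A0 A1.
  set B := sq_pos (v - r - a - h) - _ + _ in B0 B1.
  have -> : F (r + h) - F r - h * f r = (4 * a)^-1 * (B - A).
    rewrite /F /f /A /B (_ : v - (r + h) + a = v - r + a - h); last by ring.
    rewrite (_ : v - (r + h) - a = v - r - a - h); last by ring.
    field; lra.
  have p0 : 0 < (4 * a)^-1 by rewrite invr_gt0 mulr_gt0.
  by rewrite normrM (gtr0_norm p0) ler_pM2l// ler_norml; apply/andP; split; lra.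
have dF r : is_derive r (1 : R) F (f r).
  by apply: quadratic_is_derive; exact: FT.
have cF : continuous F.
  move=> r; apply: differentiable_continuous; apply/derivable1_diffP.
  by have [] := dF r.
have cp c : continuous (fun r => pos_part (v - r + c)).
  move=> r; apply: (@continuous_max _ _ (fun r => v - r + c) (fun=> 0)).
    apply: cvgD; last exact: cvg_cst.
    by apply: cvgB; [exact: cvg_cst|exact: cvg_id].
  exact: cvg_cst.
have cf : continuous f.
  move=> r; apply: cvgM; last exact: cvg_cst.
  by apply: cvgB; [exact: cp|exact: (cp (- a))].
have mf : measurable_fun setT (EFin \o f).
  by apply/measurable_EFinP; exact: continuous_measurable_fun.
have f0 r : (0 <= (f r)%:E)%E.
  rewrite lee_fin /f divr_ge0//; last by lra.
  rewrite subr_ge0 /pos_part ge_max !le_max lexx orbT andbT.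
  by apply/orP; left; lra.
have [aa R1E] := U1.
(* [uniform_prob] is a measure on [measurableTypeR R], whose display differs
   from that of [R] itself; hence the retyped copy of [R1]. *)
have mR1 : measurable_fun setT (R1 : T -> measurableTypeR R).
  exact: measurable_funPT R1.
pose R1' := HB.pack_for {RV P >-> measurableTypeR R}
  (R1 : T -> measurableTypeR R)
  (isMeasurableFun.Build _ _ _ _ (R1 : T -> measurableTypeR R) mR1).
transitivity (\int[distribution P R1']_r (f r)%:E)%E.
  rewrite ge0_integral_distribution//.
  by apply: eq_integral => w _; rewrite /= (uniform_cdfE a).
transitivity (\int[uniform_prob aa]_r (f r)%:E)%E.
  by apply: eq_measure_integral => A mA _; exact: R1E.
rewrite integral_uniform// (continuous_FTC2 (F := F))//.
- rewrite -EFinB -EFinM; congr EFin; rewrite /F /triangular_cdf.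
  rewrite (_ : v - a + a = v); last by ring.
  rewrite (_ : v - a - a = v - 2 * a); last by ring.
  rewrite (_ : v - - a + a = v + 2 * a); last by ring.
  rewrite (_ : v - - a - a = v); last by ring.
  by field; lra.
- exact: continuous_subspaceT.
- split.
  + by move=> r _; have [] := dF r.
  + by apply: cvg_at_right_filter; exact: cF.
  + by apply: cvg_at_left_filter; exact: cF.
- by move=> r _; rewrite derive1E; have [] := dF r.
Qed.
End sum_of_uniforms.

(** * Adding an independent bounded variable, to first order in its mean *)

Section shift.
Context {R : realType} {d} {T : measurableType d} {P : probability T R}.

Lemma bounded_integrable (f : T -> R) (C : R) : measurable_fun setT f ->
  (forall w, `|f w| <= C) -> P.-integrable setT (EFin \o f).
Proof.
move=> mf fC; apply: measurable_bounded_integrable => //.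
  by rewrite -ge0_fin_numE// fin_num_measure.
exists C; split; first exact: num_real.
by move=> C' CC' w _; exact: le_trans (fC w) (ltW CC').
Qed.

Lemma Rintegral_cst_probability (c : R) : \int[P]_w c = c.
Proof.
rewrite Rintegral_cst// (_ : fine _ = 1) ?mulr1//.
exact: (congr1 fine (probability_setT P)).
Qed.

Lemma dist_Rintegral_le (f g b : T -> R) :
  P.-integrable setT (EFin \o f) -> P.-integrable setT (EFin \o g) ->
  P.-integrable setT (EFin \o b) -> (forall w, `|f w - g w| <= b w) ->
  `|\int[P]_w f w - \int[P]_w g w| <= \int[P]_w b w.
Proof.
move=> fi gi bi fgb; rewrite -RintegralB//.
have fgi : P.-integrable setT (EFin \o (fun w => f w - g w)) 
    by exact: (integrableB _ fi gi).
apply: (le_trans (le_normr_Rintegral _ fgi)) => //.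
apply: le_Rintegral => //; first exact: integrable_norm fgi.
Qed.

(** The cdf of the sum averages the cdf of [Z] at t - X. An approximation affine in y averages to
    its value at the mean, and the uniform error bound survives. *)
Lemma cdf_indep_estimate (X Z : {RV P >-> R}) (t k f l M : R) :
  0 < M -> indep_RV P X Z -> supported_in P X `[- M, M] ->
  (forall y, `|y| <= M -> `|fine (cdf Z (t - y)) - (k - y * f)| <= l) ->
  exists m : R, ('E_P[X] = m%:E)%E /\
    `|fine (cdf (P := P) (X \+ Z)%R t) - (k - m * f)| <= l.
Proof.
move=> M0 XZ XM Zkfl.
have mX : measurable_fun setT X by exact: measurable_funPT.
(* [X] is bounded only almost surely; clamping gives an almost surely equal variable to which the
   estimate applies at every point. *)
pose X' w : R := Num.min M (Num.max (- M) (X w)).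
have mX' : measurable_fun setT X'.
  by apply: measurable_minr => //; apply: measurable_maxr.
have X'M w : `|X' w| <= M.
  by rewrite ler_norml le_min ge_min le_max !lexx /= andbT; lra.
have mXI : measurable (X @^-1` `[- M, M]).
  by rewrite -[X in measurable X]setTI; apply: mX => //; exact: measurable_itv.
have aeX : \forall w \ae P, setT w -> X w = X' w.
  exists (X @^-1` (~` `[- M, M])); split.
  - by rewrite preimage_setC; exact: measurableC.
  - rewrite preimage_setC (probability_setC P mXI).
    by rewrite [X in (1 - X)%E]XM subee.
  - move=> w /= XX'; apply: contra_not XX'; rewrite in_itv/= => /andP[h1 h2] _.
    by rewrite /X' max_r// min_r.
pose g y : R := fine (cdf Z (t - y)).
have mg : measurable_fun setT g.
  have mc : measurable_fun setT (fine \o cdf Z).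
    by apply: measurableT_comp => //; exact: cdf_measurable.
  apply: (measurableT_comp mc); exact: measurable_funB.
have g1 y : `|g y| <= 1.
  rewrite ger0_norm ?fine_ge0 ?cdf_ge0// -lee_fin fineK ?cdf_le1//.
  exact: fin_num_measure.
have mgX : measurable_fun setT (g \o X) by exact: measurableT_comp.
have mgX' : measurable_fun setT (g \o X') by exact: measurableT_comp.
have igX' : P.-integrable setT (EFin \o (g \o X')).
  by apply: (@bounded_integrable _ 1) => // w; exact: g1.
have iX' : P.-integrable setT (EFin \o X') by exact: (@bounded_integrable _ M).
exists (\int[P]_w X' w); split.
  rewrite unlock fineK; last exact: integrable_fin_num.
  apply: ae_eq_integral => //; [|by apply/measurable_EFinP|].
    by apply/measurable_EFinP; exact: measurable_funPT.
  by apply: filterS aeX => w h /h ->.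
have -> : fine (cdf (P := P) (X \+ Z)%R t) = \int[P]_w g (X' w).
  rewrite cdfD_indep//; congr fine.
  transitivity (\int[P]_w (g (X w))%:E)%E.
    by apply: eq_integral => w _; rewrite /g fineK// fin_num_measure.
  apply: ae_eq_integral => //; [exact/measurable_EFinP|exact/measurable_EFinP|].
  by apply: filterS aeX => w h /h ->.
have ifX' : P.-integrable setT (EFin \o (fun w => X' w * f)).
  exact: (integrableZr measurableT f iX').
have ic (c : R) : P.-integrable setT (EFin \o (fun=> c)).
  by apply: (@bounded_integrable _ `|c|).
have -> : k - \int[P]_w X' w * f = \int[P]_w (k - X' w * f).
  by rewrite RintegralB// RintegralZr// Rintegral_cst_probability.
have <- : \int[P]_w l = l by rewrite Rintegral_cst_probability.
apply: dist_Rintegral_le => //.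
  exact: (integrableB _ (ic k) ifX').
by move=> w; exact: Zkfl.
Qed.

End shift.

(** * The weight w and the resulting lower bound on the gap between the cdfs *)

Section noise.
Context {R : realType} {d} {T : measurableType d} {P : probability T R}.

Lemma measurable_norm_le (r : R) : measurable [set v : R | `|v| <= r].
Proof.
have -> : [set v : R | `|v| <= r] = `[- r, r]%classic.
  by apply/seteqP; split => v; rewrite /= in_itv/= ler_norml.
exact: measurable_itv.
Qed.

Lemma measurable_norm_lt_le (r1 r2 : R) :
  measurable [set v : R | r1 < `|v| <= r2].
Proof.
have -> : [set v : R | r1 < `|v| <= r2] =
    [set v | `|v| <= r2] `\` [set v | `|v| <= r1].
  apply/seteqP; split => v; rewrite /= ltNge.
    by move=> /andP[/negP ? ?].
  by move=> [-> /negP ->].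
by apply: measurableD; exact: measurable_norm_le.
Qed.

Lemma measurable_reflection (t : R) (D : set R) : measurable D ->
  measurable [set s | D (t - s)].
Proof.
move=> mD; have mt : measurable_fun setT (fun s : R => t - s).
  exact: measurable_funB.
by rewrite -[X in measurable X]setTI; exact: mt.
Qed.

Lemma measurable_triangular_cdf (a : R) :
  measurable_fun setT (triangular_cdf a).
Proof.
have mq (c : R) : measurable_fun setT (fun v : R => sq_pos (v + c)).
  apply: measurable_funX; apply: measurable_maxr => //.
  exact: measurable_funD.
apply: measurable_funM => //.
apply: measurable_funD; last exact: (mq (- (2 * a))).
apply: measurable_funB; first exact: mq.
apply: measurable_funM => //; apply: measurable_funX; exact: measurable_maxr.
Qed.

Lemma measurable_triangular_pdf (a : R) :
  measurable_fun setT (triangular_pdf a).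
Proof.
have mq (c : R) : measurable_fun setT (fun v : R => pos_part (v + c)).
  apply: measurable_maxr => //; exact: measurable_funD.
apply: measurable_funM => //.
apply: measurable_funD; last exact: (mq (- (2 * a))).
apply: measurable_funB; first exact: mq.
apply: measurable_funM => //; exact: measurable_maxr.
Qed.

Lemma Rintegral_indic_probability (A : set T) : measurable A ->
  \int[P]_w \1_A w = fine (P A).
Proof. by move=> mA; rewrite /Rintegral integral_indic// setIT. Qed.

(** On the core 2a - |v| is at least a - 2M, and eps (a - 2M) - 2M >= 8M is the assumption on [a]
    rearranged. On the collar only the nonnegativity of the tent is used. *)
Lemma weight_ge (a eps M v : R) : 0 < M -> 0 < eps ->
  10 * M + 2 * eps * M <= eps * a ->
  8 * M * \1_[set v | `|v| <= a + 2 * M] v -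
  2 * M * \1_[set v | a + 2 * M < `|v| <= 2 * a + M] v <=
  eps * pos_part (2 * a - `|v|) - 2 * M * \1_[set v | `|v| <= 2 * a + M] v.
Proof.
move=> M0 eps0 Ma; have aM : 2 * M < a by nra.
rewrite !indicE /pos_part.
have memE (p : R -> bool) : (v \in [set v | p v]) = p v.
  by apply/idP/idP; rewrite in_setE.
rewrite (memE (fun v => `|v| <= a + 2 * M)).
rewrite (memE (fun v => a + 2 * M < `|v| <= 2 * a + M)).
rewrite (memE (fun v => `|v| <= 2 * a + M)).
have [h1|h1] := leP `|v| (a + 2 * M).
  rewrite (_ : `|v| <= 2 * a + M); last by lra.
  rewrite max_l; last by lra.
  rewrite /= !mulr1 mulr0 subr0; nra.
have [h2|h2] := leP `|v| (2 * a + M) => /=.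
  have : 0 <= Num.max (2 * a - `|v|) 0 by rewrite le_max lexx orbT.
  move=> /(mulr_ge0 (ltW eps0)); lra.
rewrite max_r; last by lra.
by rewrite !mulr0.
Qed.

(** With k = E[H(t - S)] and f = E[rho(t - S)], both cdfs are k minus the mean times f, each up to
    an error l. The gap is thus at least eps M f - 2l, which is M / (4a^2) times E[w(t - S)]. *)
Lemma triangular_noise_cdf_gap (a eps M t : R) (S Q X Y : {RV P >-> R}) :
  0 < M -> 0 < eps -> 10 * M + 2 * eps * M <= eps * a ->
  indep_RV P Q S -> (forall v, cdf Q v = (triangular_cdf a v)%:E) ->
  indep_RV P X (Q \+ S) -> indep_RV P Y (Q \+ S) ->
  supported_in P X `[- M, M] -> supported_in P Y `[- M, M] ->
  ('E_P[X] - 'E_P[Y] >= (eps * M)%:E)%E ->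
  M / (4 * a ^+ 2) *
    (8 * M * fine (P (S @^-1` [set s | `|t - s| <= a + 2 * M])) -
     2 * M * fine (P (S @^-1` [set s | a + 2 * M < `|t - s| <= 2 * a + M]))) <=
  fine (cdf (P := P) (Y \+ (Q \+ S)) t) - fine (cdf (P := P) (X \+ (Q \+ S)) t).
Proof.
move=> M0 eps0 Ma QS cQ XZ YZ XM YM EXY.
have aM : 2 * M < a by nra.
have a0 : 0 < a by lra.
have a20 : 0 < 4 * a ^+ 2 by rewrite mulr_gt0// exprn_gt0.
pose V w := t - S w.
have mS : measurable_fun setT S by exact: measurable_funPT.
have mV : measurable_fun setT V by exact: measurable_funB.
have cdfE u : fine (cdf (P := P) (Q \+ S) u) =
    \int[P]_w triangular_cdf a (u - S w).
  (* Commuting the sum makes [cdfD_indep] integrate over [S], with the explicit cdf of [Q]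
     inside. *)
  have -> : cdf (P := P) (Q \+ S) u = cdf (P := P) (S \+ Q) u.
    by congr (P _); apply/seteqP; split => w; rewrite /= !in_itv/= addrC.
  rewrite cdfD_indep; last by move=> A B hA hB; rewrite setIC muleC; exact: QS.
  by congr fine; apply: eq_integral => w _; rewrite cQ.
have icdf u :
    P.-integrable setT (EFin \o (fun w => triangular_cdf a (u - S w))).
  apply: (@bounded_integrable _ _ _ _ _ 1).
    apply: (measurableT_comp (measurable_triangular_cdf a)).
    exact: measurable_funB.
  (* The bound 1 comes from reading [triangular_cdf] back as the cdf of [Q]. *)
  move=> w; rewrite -[triangular_cdf _ _]/(fine (_%:E)) -cQ.
  rewrite ger0_norm ?fine_ge0 ?cdf_ge0// -lee_fin fineK ?cdf_le1//.
  exact: fin_num_measure.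
have ipdf : P.-integrable setT (EFin \o (triangular_pdf a \o V)).
  apply: (@bounded_integrable _ _ _ _ _ ((2 * a) / (4 * a ^+ 2))).
    exact: (measurableT_comp (measurable_triangular_pdf a)).
  move=> w; have pos_ge0 : 0 <= pos_part (2 * a - `|V w|).
    by rewrite /pos_part le_max lexx orbT.
  rewrite /= triangular_pdfE// ger0_norm; last by rewrite divr_ge0// ltW.
  rewrite ler_pM2r ?invr_gt0// /pos_part ge_max.
  by apply/andP; split; [have := normr_ge0 (V w)|]; lra.
have iind (D : set R) : measurable D ->
    P.-integrable setT (EFin \o (\1_D \o V)).
  move=> mD; apply: (@bounded_integrable _ _ _ _ _ 1).
    by apply: (measurableT_comp _ mV); exact: measurable_indic.
  by move=> w /=; rewrite indicE; case: (_ \in _); rewrite ?normr1 ?normr0.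
have iZ (f : T -> R) (c : R) : P.-integrable setT (EFin \o f) ->
    P.-integrable setT (EFin \o (fun w => c * f w)).
  by move=> fi; exact: (integrableZl measurableT c fi).
have iB (f g : T -> R) : P.-integrable setT (EFin \o f) ->
    P.-integrable setT (EFin \o g) ->
    P.-integrable setT (EFin \o (fun w => f w - g w)).
  by move=> fi gi; exact: (integrableB measurableT fi gi).
have indE (D : set R) : measurable D ->
    \int[P]_w \1_D (V w) = fine (P (S @^-1` [set s | D (t - s)])).
  move=> mD; rewrite -Rintegral_indic_probability; last first.
    by rewrite -[X in measurable X]setTI; exact: mV.
  by apply: eq_Rintegral => w _; rewrite !indicE; congr (_%:R); apply/idP/idP;
    rewrite !in_setE.
pose k := \int[P]_w triangular_cdf a (V w).
pose f := \int[P]_w triangular_pdf a (V w).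
pose A := [set v : R | `|v| <= 2 * a + M].
pose C := [set v : R | `|v| <= a + 2 * M].
pose B := [set v : R | a + 2 * M < `|v| <= 2 * a + M].
have mA : measurable A by exact: measurable_norm_le.
have mC : measurable C by exact: measurable_norm_le.
have mB : measurable B by exact: measurable_norm_lt_le.
pose c := M ^+ 2 / (4 * a ^+ 2).
pose l := \int[P]_w (c * \1_A (V w)).
have est y : `|y| <= M ->
    `|fine (cdf (P := P) (Q \+ S) (t - y)) - (k - y * f)| <= l.
  move=> yM; rewrite cdfE.
  have -> : k - y * f =
      \int[P]_w (triangular_cdf a (V w) - y * triangular_pdf a (V w)).
    by rewrite RintegralB// ?RintegralZl//; [exact: icdf|exact: iZ].
  apply: dist_Rintegral_le => //.
  - by apply: iB; [exact: icdf|exact: iZ].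
  - by apply: iZ; exact: (iind A).
  - move=> w; rewrite addrAC; exact: triangular_cdf_taylor.
have [mX [EX Xest]] := @cdf_indep_estimate _ _ _ _ X _ t k f l M M0 XZ XM est.
have [mY [EY Yest]] := @cdf_indep_estimate _ _ _ _ Y _ t k f l M M0 YZ YM est.
move: EXY; rewrite EX EY lee_fin => EXY.
have f0 : 0 <= f.
  apply: Rintegral_ge0 => w _; rewrite triangular_pdfE//.
  by apply: divr_ge0; [|exact: ltW]; rewrite /pos_part le_max lexx orbT.
apply: (@le_trans _ _ (eps * M * f - 2 * l)); last first.
  move: Xest Yest; rewrite !ler_norml => /andP[_ X2] /andP[Y1 _].
  have : eps * M * f <= (mX - mY) * f by rewrite ler_wpM2r.
  lra.
have iA := iind A mA; have iB' := iind B mB; have iC := iind C mC.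
(* Since 4a^2 rho(v) is the positive part of 2a - |v|, the right-hand side is E[w(t - S)]. *)
have : \int[P]_w (8 * M * \1_C (V w) - 2 * M * \1_B (V w)) <=
    \int[P]_w (eps * (4 * a ^+ 2) * triangular_pdf a (V w) -
      2 * M * \1_A (V w)).
  apply: le_Rintegral => //; [by apply: iB; exact: iZ|by apply: iB; exact: iZ|].
  move=> w _; apply: (le_trans (weight_ge _ _ _ _ M0 eps0 Ma)).
  rewrite triangular_pdfE// le_eqVlt; apply/orP; left; apply/eqP; field; lra.
rewrite !RintegralB ?RintegralZl//; try exact: iZ.
rewrite /l RintegralZl// -(indE C mC) -(indE B mB) -/f.
set EC := \int[P]_w \1_C _; set EB := \int[P]_w \1_B _.
set EA := \int[P]_w \1_A _ => h.
have -> : eps * M * f - 2 * (c * EA) =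
    M / (4 * a ^+ 2) * (eps * (4 * a ^+ 2) * f - 2 * M * EA).
  by rewrite /c; field; lra.
by rewrite ler_wpM2l// divr_ge0// ltW.
Qed.
End noise.

(** * Balance of core against collar, with the event N = 0 left over *)

Theorem theorem3 (R : realType) (d : measure_display) (T : measurableType d)
    (P : probability T R) (M eps a : R)
    (M_gt0 : 0 < M) (eps_gt0 : 0 < eps)
    (a_ge : 16 * M * eps^-1 + 8 * M <= a)
    (* U i stands for U_{i+1} *)
    (U : nat -> {RV P >-> R}) (N : {RV P >-> nat}) (R1 R2 : {RV P >-> R})
    (U_unif : forall i, uniform_on_RV P
       (`[- a - M, - a + M] `|` `[a - M, a + M]) (U i))
    (U_indep : mutually_indep_RV P U)
    (N_law : forall n : nat, P (N @^-1` [set n]) = (2 ^- (1 + n))%:E)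
    (NU_indep : indep_classes P (g_sigma_algebra_preimage N)
       <<s \bigcup_i g_sigma_algebra_preimage (U i) >>)
    (R1_unif : uniform_itv_RV P (- a) a R1)
    (R2_unif : uniform_itv_RV P (- a) a R2)
    (R1R2_indep : indep_RV P R1 R2)
    (R_NU_indep : indep_classes P
       <<s g_sigma_algebra_preimage R1 `|` g_sigma_algebra_preimage R2 >>
       <<s g_sigma_algebra_preimage N `|`
           \bigcup_i g_sigma_algebra_preimage (U i) >>) :
  let Z : {RV P >-> R} := R1 \+ R2 \+ random_sum U N in
  forall X Y : {RV P >-> R},
    indep_RV P X Z -> indep_RV P Y Z ->
    supported_in P X `[- M, M] -> supported_in P Y `[- M, M] ->
    ('E_P[X] - 'E_P[Y] >= (eps * M)%:E)%E ->
    fosd_gt P (X \+ Z) (Y \+ Z).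
Proof.
move=> Z X Y XZ YZ XM YM EXY.
have epsa : 16 * M + 8 * M * eps <= eps * a.
  rewrite (_ : _ + _ = eps * (16 * M * eps^-1 + 8 * M)).
    by rewrite ler_pM2l.
  by field; rewrite gt_eqF.
have Ma : 10 * M + 2 * eps * M <= eps * a by nra.
have M4a : 4 * M <= a.
  apply: le_trans a_ge; rewrite -[leLHS]add0r.
  by rewrite lerD ?mulr_ge0 ?invr_ge0 ?ltW//; lra.
have a0 : 0 < a by lra.
have QS := @addR_random_sum_indep _ _ _ _ U N R1 R2 R_NU_indep.
have cQ v := @cdf_sum_uniformE _ _ _ _ a v R1 R2 a0 R1_unif R2_unif R1R2_indep.
have gap t := @triangular_noise_cdf_gap _ _ _ _ a eps M t (random_sum U N)
  (R1 \+ R2) X Y M_gt0 eps_gt0 Ma QS cQ XZ YZ XM YM EXY.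
pose B t : set R := [set s | a + 2 * M < `|t - s| <= 2 * a + M].
pose C t : set R := [set s | `|t - s| <= a + 2 * M].
have mC t : measurable (C t).
  exact: measurable_reflection (measurable_norm_le _).
have mB t : measurable (B t).
  exact: measurable_reflection (measurable_norm_lt_le _ _).
have mS (D : set R) : measurable D -> measurable (random_sum U N @^-1` D).
  by move=> mD; rewrite -[X in measurable X]setTI; exact: measurable_random_sum.
have mN (D : set nat) : measurable (N @^-1` D) by exact: measurable_funPTI.
have mNS (D : set nat) t : measurable (N @^-1` D `&` random_sum U N @^-1` C t).
  by apply: measurableI => //; exact: mS.
have far t : fine (P (random_sum U N @^-1` B t)) <=
    4 * fine (P (N @^-1` [set n | (0 < n)%N] `&` random_sum U N @^-1` C t)).
  rewrite -lee_fin EFinM !fineK.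
  apply: (random_sum_geometric_le U N) => // n.
  - exact: partial_sum_step_le.
  - exact: fin_num_measure.
  - by apply: fin_num_measure; exact: mS.
(* Only the part of the core with N > 0 is spent on the collar. *)
have near t : fine (P (random_sum U N @^-1` C t)) =
    fine (P (N @^-1` [set 0%N] `&` random_sum U N @^-1` C t)) +
    fine (P (N @^-1` [set n | (0 < n)%N] `&` random_sum U N @^-1` C t)).
  rewrite -fineD ?fin_num_measure//; congr fine.
  transitivity (P ((N @^-1` [set 0%N] `&` random_sum U N @^-1` C t) `|`
    (N @^-1` [set n | (0 < n)%N] `&` random_sum U N @^-1` C t))).
    congr (P _); rewrite -setIUl -preimage_setU (_ : _ `|` _ = setT).
      by rewrite preimage_setT setTI.
    by apply/seteqP; split => // -[|n] _; [left|right].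
  apply: measureU => //; apply/seteqP; split => // w [[/= + _] [+ _]].
  by move=> ->.
have K_gt0 : 0 < M / (4 * a ^+ 2) by rewrite divr_gt0// mulr_gt0// exprn_gt0.
pose F (W : {RV P >-> R}) t := fine (cdf (P := P) (W \+ Z) t).
(* The collar costs at most 2M times 4 P(core, N > 0), which the gain 8M on that part of the core
   cancels exactly; the part with N = 0 remains. *)
have gap' t : M / (4 * a ^+ 2) * (8 * M *
    fine (P (N @^-1` [set 0%N] `&` random_sum U N @^-1` C t))) <= F Y t - F X t.
  apply: le_trans (gap t); rewrite ler_wpM2l ?(ltW K_gt0)//.
  by have := far t; rewrite near; nra.
split.
  apply: cdf_le_fosd_ge => t.
  rewrite -[leLHS]fineK ?fin_num_measure// -[leRHS]fineK ?fin_num_measure//.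
  rewrite lee_fin -subr_ge0; apply: le_trans (gap' t).
  by rewrite mulr_ge0 ?(ltW K_gt0)// mulr_ge0 ?fine_ge0// mulr_ge0// ltW.
(* Equal laws would give equal cdfs at 0. But N = 0 forces S = 0, which lies in the core for t = 0,
   so the gap there is at least a positive multiple of P(N = 0) = 1/2. *)
move=> /(_ `]-oo, 0]%classic (measurable_itv _)) XY.
have := gap' 0; rewrite /F /cdf XY subrr.
have -> : N @^-1` [set 0%N] `&` random_sum U N @^-1` C 0 = N @^-1` [set 0%N].
  apply/setIidl => w /= Nw0.
  by rewrite /C/= /random_sum Nw0 big_ord0 subrr normr0; lra.
rewrite N_law/=; apply/negP; rewrite -ltNge mulr_gt0// mulr_gt0 ?invr_gt0//.
by rewrite mulr_gt0.
Qed.
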